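(* Suppose that an open subset $E$ of $\mathbb{R}$ satisfies $$0\in E,\qquad -E=E\qquad\text{and}\qquad \mathrm{comp}(E)=\infty.$$ Let $\{E_j\}_{j\in\Sigma}$ be the family of open connected components of $E$. Assume that there is $\sigma>0$ such that $$\inf_{j\in\Sigma}\Bigl(\sup_{a,b\in E_j}|a-b|\Bigr)=2\sigma.$$ Then, for any $n\in\mathbb{N}$, $n\ge 2$, there exists $f\in PD_n(\mathbb{R})$ such that $S_f=E$ and $$\mathrm{card}(D_n(f))=\infty.$$
   Context: $\mathbb{N}$ denotes the positive integers. A function $f:\mathbb{R}\to\mathbb{C}$ is positive definite if $\sum_{j,l=1}^{m} f(x_j-x_l)c_j\overline{c_l}\ge 0$ for every $m\in\mathbb{N}$, all $c_1,\dots,c_m\in\mathbb{C}$ and all $x_1,\dots,x_m\in\mathbb{R}$. $PD(\mathbb{R})$ denotes the family of continuous positive definite functions $f:\mathbb{R}\to\mathbb{C}$ that are not identically zero. For an integer $n\ge 2$, a function $f\in PD(\mathbb{R})$ is called $n$-divisible if there is $g\in PD(\mathbb{R})$ with $g^n=f$ (pointwise $n$-th power: $g(x)^n=f(x)$ for all $x\in\mathbb{R}$); $PD_n(\mathbb{R})$ denotes the family of all $n$-divisible functions in $PD(\mathbb{R})$. For $f\in PD_n(\mathbb{R})$, set $D_n(f)=\{g\in PD(\mathbb{R}): g^n=f\}$, and $\mathrm{card}(D_n(f))$ is the cardinality of this set; $\mathrm{card}(D_n(f))=\infty$ means that $D_n(f)$ is an infinite set. For $f\in PD(\mathbb{R})$,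 $S_f=\{x\in\mathbb{R}: f(x)\neq 0\}$ (an open subset of $\mathbb{R}$). For an open set $E\subset\mathbb{R}$, $-E=\{-x:x\in E\}$ and $\mathrm{comp}(E)$ denotes the number (cardinality of the family) of connected components of $E$; $\mathrm{comp}(E)=\infty$ means that $E$ has infinitely many connected components. *)

(* Defs.v *)
From HB Require Import structures.
From mathcomp Require Import all_boot all_order all_algebra.
From mathcomp Require Import complex.
From mathcomp Require Import all_classical all_reals all_analysis.

Set Implicit Arguments.
Unset Strict Implicit.
Unset Printing Implicit Defensive.

Import Order.TTheory GRing.Theory Num.Theory.
Import numFieldNormedType.Exports.
Local Open Scope classical_set_scope.
Local Open Scope ring_scope.

(* The order of [R[i]] is partial: [0 <= z] says that z is real and
   nonnegative. *)
Definition positive_definite (R : realType) (f : R -> R[i]) : Prop :=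
  forall (m : nat) (c : 'I_m -> R[i]) (x : 'I_m -> R), (0 < m)%N ->
    0 <= \sum_(j < m) \sum_(l < m) f (x j - x l) * c j * Num.conj (c l).

(* The alias [R[i]^o] carries the topology of the modulus. *)
Definition PD (R : realType) : set (R -> R[i]) :=
  [set f | [/\ continuous (f : R -> R[i]^o),
               positive_definite f
             & exists x, f x != 0]].

Definition Dn (R : realType) (n : nat) (f : R -> R[i]) : set (R -> R[i]) :=
  [set g | PD g /\ forall x, g x ^+ n = f x].

Definition PDn (R : realType) (n : nat) : set (R -> R[i]) :=
  [set f | PD f /\ exists2 g, PD g & forall x, g x ^+ n = f x].

Definition nonzero_set (R : realType) (f : R -> R[i]) : set R :=
  [set x | f x != 0].

(* A component is counted once, whatever the point it is obtained from. *)
Definition components (R : realType) (E : set R) : set (set R) :=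
  connected_component E @` E.

(* Extended-real valued, since a component may be unbounded. *)
Definition diameter (R : realType) (A : set R) : \bar R :=
  ereal_sup [set (`|a - b| : R)%:E | a in A & b in A].

(* Main.v *)
Require Import Defs.
From HB Require Import structures.
From mathcomp Require Import all_boot all_order all_algebra.
From mathcomp Require Import spectral ring lra.
From mathcomp Require Import complex.
From mathcomp Require Import all_classical all_reals all_analysis.
Import Order.TTheory GRing.Theory Num.Theory.
Import numFieldNormedType.Exports.
Local Open Scope classical_set_scope.
Local Open Scope ring_scope.

(** Let [tent t x = max 0 (t - |x|)]. It is positive definite, because
    [tent t (x - y)] is the length of the overlap of two windows of length [t]
    translated by [x] and [y], so that its kernel is a Gram matrix
    ([positive_definite_tent]). The point of the proof is that, for [f]
    positive definite and [|z| = 1],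

      2 f(x) + z f(x - a) + conj z f(x + a)

    is again positive definite, whatever [z] is
    ([positive_definite_translates]): a bump far from the origin may be
    rotated by an arbitrary phase, as long as the opposite bump is rotated by
    the conjugate one and twice the bump sits at the origin.

    The lower bound on the diameters makes [E] the union of the balls
    [ball q t] contained in [E] with [q] rational, for [t = sigma / 2]
    ([wide_cover]), and [ball 0 t] is one of them ([wide_ball0]). Summing the
    functions above, for [f = tent t] and [a] running over these [q], with
    summable positive weights and all phases equal to 1, gives a nonnegative
    Lipschitz function [profile], nonzero exactly on [E]. Let now [w] be a
    phase: a function of modulus 1, constant on each component of [E],
    equal to 1 at 0 and with [w (- x) = conj (w x)]. Each bump lives in one
    component, so that [w * profile] is the same sum with rotated bumps
    ([phase_twist]); hence it lies in PD ([phase_PD]).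

    Take [f = profile ^ n], which is positive definite by the Schur product
    theorem ([psd_schur]). If moreover [w ^ n = 1], then [w * profile] is an
    [n]-th root of [f]. For [z != 1] with [z ^ n = 1] and a component [C] of
    [E] that avoids 0, the function equal to [z] on [C], to [conj z] on [- C]
    and to 1 elsewhere is such a phase, and the root that it defines differs
    from [profile] exactly on the union of [C] and [- C]. A root thus comes
    from at most two components; as there are infinitely many components, [f]
    has infinitely many roots. *)

Set Implicit Arguments.
Unset Strict Implicit.
Unset Printing Implicit Defensive.

(** * Positive semidefinite kernels and positive definite functions *)

Definition psd (C : numClosedFieldType) m (A : 'M[C]_m) : Prop :=
  forall c : 'I_m -> C,
    0 <= \sum_(j < m) \sum_(l < m) A j l * c j * Num.conj (c l).

(** The eigenvalue [s r] is the value of the form of [A] at the [r]-th row of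
    the unitary matrix [P], hence it is nonnegative. *)
Lemma psd_spectral (C : numClosedFieldType) m (A : 'M[C]_m) :
  (forall j l, A l j = Num.conj (A j l)) -> psd A ->
  exists (P : 'M[C]_m) (s : 'I_m -> C), (forall r, 0 <= s r) /\
    forall j l, A j l = \sum_(r < m) s r * Num.conj (P r j) * P r l.
Proof.
move=> hA pA.
have /hermitian_normalmx/orthomx_spectralP : A \is hermsymmx.
  apply/is_hermitianmxP; rewrite expr0 scale1r; apply/matrixP => j l.
  by rewrite !mxE hA.
set P := spectralmx A; set s := spectral_diag A => AE.
have uP : P \is unitarymx by exact: spectral_unitarymx.
exists P, (fun r => s 0 r); split => [r|j l]; last first.
  rewrite {1}AE invmx_unitary// -mulmxA !mxE; apply: eq_bigr => r _.
  by rewrite mul_diag_mx !mxE mulrCA mulrA.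
have : P *m A *m (map_mx Num.conj P^T) = diag_mx s.
  by rewrite {1}AE -(invmx_unitary uP) !mulmxA mulmxV
    ?unitarymx_unit// mul1mx mulmxK// unitarymx_unit.
move/matrixP => /(_ r r); rewrite [RHS]mxE eqxx mulr1n => <-.
rewrite mxE; under eq_bigr do rewrite mxE big_distrl /=.
rewrite exchange_big /=.
have := pA (fun j => P r j); congr (0 <= _).
apply: eq_bigr => j _; apply: eq_bigr => l _.
by rewrite !mxE [A j l * _]mulrC.
Qed.

(** In terms of the spectral decomposition of [A], the form of the entrywise
    product of [A] and [B] at [c] is a nonnegative combination of values of
    the form of [B]. *)
Lemma psd_schur (C : numClosedFieldType) m (A B : 'M[C]_m) :
  (forall j l, A l j = Num.conj (A j l)) -> psd A -> psd B ->
  psd (\matrix_(j, l) (A j l * B j l)).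
Proof.
move=> hA /(psd_spectral hA)[P [s [s0 AE]]] pB c.
rewrite (_ : \sum_j _ = \sum_(r < m) s r * \sum_(j < m) \sum_(l < m)
    B j l * (c j * Num.conj (P r j)) * Num.conj (c l * Num.conj (P r l))).
  by apply: sumr_ge0 => r _; rewrite mulr_ge0// pB.
under [RHS]eq_bigr do rewrite mulr_sumr.
rewrite [RHS]exchange_big/=; apply: eq_bigr => j _.
under [RHS]eq_bigr do rewrite mulr_sumr.
rewrite [RHS]exchange_big/=; apply: eq_bigr => l _.
rewrite mxE AE !mulr_suml; apply: eq_bigr => r _.
rewrite rmorphM /= conjCK; ring.
Qed.

Lemma positive_definiteM (R : realType) (f g : R -> R[i]) :
  (forall x, f (- x) = Num.conj (f x)) ->
  positive_definite f -> positive_definite g ->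
  positive_definite (fun x => f x * g x).
Proof.
move=> hf pf pg m c x m0.
pose A (h : R -> R[i]) : 'M[R[i]]_m := \matrix_(j, l) h (x j - x l).
have pA h : positive_definite h -> psd (A h).
  move=> ph d; have := ph m d x m0; congr (0 <= _).
  by apply: eq_bigr => j _; apply: eq_bigr => l _; rewrite mxE.
have hA j l : A f l j = Num.conj (A f j l) by rewrite !mxE -hf opprB.
have := psd_schur hA (pA f pf) (pA g pg) c; congr (0 <= _).
by apply: eq_bigr => j _; apply: eq_bigr => l _; rewrite !mxE.
Qed.

Lemma positive_definite1 (R : realType) : positive_definite (fun _ : R => 1 : R[i]).
Proof.
move=> m c x _.
have -> : \sum_(j < m) \sum_(l < m) 1 * c j * Num.conj (c l) =
    (\sum_(j < m) c j) * Num.conj (\sum_(j < m) c j).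
  rewrite rmorph_sum big_distrlr /=.
  by apply: eq_bigr => j _; apply: eq_bigr => l _; rewrite mul1r.
by rewrite mul_conjC_ge0.
Qed.

Lemma positive_definiteX (R : realType) (f : R -> R[i]) n :
  (forall x, f (- x) = Num.conj (f x)) ->
  positive_definite f -> positive_definite (fun x => f x ^+ n).
Proof.
move=> hf pf; elim: n => [|n IHn]; first exact: positive_definite1.
under eq_fun do rewrite exprS.
by move=> m c x; apply: (positive_definiteM hf pf IHn).
Qed.

Lemma positive_definiteZ (R : realType) (f : R -> R[i]) (k : R[i]) :
  0 <= k -> positive_definite f -> positive_definite (fun x => k * f x).
Proof.
move=> k0 pf m c x m0.
rewrite (_ : \sum_j _ =
  k * \sum_(j < m) \sum_(l < m) f (x j - x l) * c j * Num.conj (c l)).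
  by rewrite mulr_ge0// pf.
rewrite mulr_sumr; apply: eq_bigr => j _; rewrite mulr_sumr.
by apply: eq_bigr => l _; rewrite !mulrA.
Qed.

Lemma positive_definite_sum (R : realType) (I : Type) (s : seq I) (f : I -> R -> R[i]) :
  (forall i, positive_definite (f i)) ->
  positive_definite (fun x => \sum_(i <- s) f i x).
Proof.
move=> pf m c x m0.
rewrite (_ : \sum_j _ =
  \sum_(i <- s) \sum_(j < m) \sum_(l < m) f i (x j - x l) * c j * Num.conj (c l)).
  by apply: sumr_ge0 => i _; exact: pf.
rewrite [RHS]exchange_big/=; apply: eq_bigr => j _.
rewrite [RHS]exchange_big/=; apply: eq_bigr => l _.
by rewrite !mulr_suml.
Qed.

(** This is the form of [f] at the [m + m] points [x j] and [x j + a], with the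
    coefficients [c j] and [conj z * c j]: the two diagonal blocks give
    [2 * f] since [|z| = 1], the other two give the translates. *)
Lemma positive_definite_translates (R : realType) (f : R -> R[i]) (a : R) (z : R[i]) :
  `|z| = 1 -> positive_definite f ->
  positive_definite
    (fun x => 2 * f x + z * f (x - a) + Num.conj z * f (x + a)).
Proof.
move=> z1 pf m c x m0.
have zz : z * Num.conj z = 1 by rewrite -normCK z1 expr1n.
pose y (j : 'I_(m + m)) : R :=
  row_mx (\row_(j < m) x j) (\row_(j < m) (x j + a)) 0 j.
pose d (j : 'I_(m + m)) : R[i] :=
  row_mx (\row_(j < m) c j) (\row_(j < m) (Num.conj z * c j)) 0 j.
have mm0 : (0 < m + m)%N by rewrite addn_gt0 m0.
have := pf (m + m)%N d y mm0; congr (0 <= _).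
rewrite big_split_ord /= -big_split /=; apply: eq_bigr => j _.
rewrite !big_split_ord /= -!big_split /=; apply: eq_bigr => l _.
rewrite /d /y !row_mxEl !row_mxEr !mxE.
rewrite (_ : x j - (x l + a) = x j - x l - a); last by ring.
rewrite (_ : x j + a - x l = x j - x l + a); last by ring.
rewrite (_ : x j + a - (x l + a) = x j - x l); last by ring.
rewrite rmorphM /= conjCK.
rewrite (_ : f (x j - x l) * (Num.conj z * c j) * (z * Num.conj (c l)) =
   (z * Num.conj z) * (f (x j - x l) * c j * Num.conj (c l))); last by ring.
rewrite zz; ring.
Qed.

(** * The tent function *)

Definition tent (R : realType) (t x : R) : R := Num.max 0 (t - `|x|).

Lemma tent_ge0 (R : realType) (t x : R) : 0 <= tent t x.
Proof. by rewrite /tent le_max lexx. Qed.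

Lemma tent_le (R : realType) (t : R) (t0 : 0 <= t) (x : R) : tent t x <= t.
Proof. by rewrite /tent ge_max t0 gerBl normr_ge0. Qed.

Lemma tent_eq0 (R : realType) (t x : R) : t <= `|x| -> tent t x = 0.
Proof. by move=> tx; apply/max_idPl; rewrite subr_le0. Qed.

Lemma tent_gt0 (R : realType) (t x : R) : `|x| < t -> 0 < tent t x.
Proof. by move=> tx; rewrite /tent lt_max subr_gt0 tx orbT. Qed.

Lemma tent_lipschitz (R : realType) (t x y : R) :
  tent t x <= tent t y + `|x - y|.
Proof.
have xy : `|y| <= `|x| + `|x - y|.
  by rewrite -[in leLHS](subrK x y) addrC (distrC x); exact: ler_normD.
have := normr_ge0 (x - y); rewrite {1}/tent ge_max => h.
rewrite addr_ge0 ?tent_ge0//= /tent.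
apply: (@le_trans _ _ (t - `|y| + `|x - y|)); first by lra.
by rewrite lerD2r le_max lexx orbT.
Qed.

Lemma itv_translatesI (R : realType) (t x y : R) :
  [set` `[x, x + t]] `&` [set` `[y, y + t]] =
  [set` `[Num.max x y, Num.min x y + t]].
Proof.
apply/seteqP; split => z /=; rewrite !in_itv /= addr_minl ge_max le_min.
  by move=> [/andP[-> ->] /andP[-> ->]].
by move=> /andP[/andP[-> ->] /andP[-> ->]].
Qed.

Lemma tent_overlap (R : realType) (t x y : R) :
  lebesgue_measure ([set` `[x, x + t]] `&` [set` `[y, y + t]]) =
  (tent t (x - y))%:E.
Proof.
rewrite itv_translatesI lebesgue_measure_itv /= lte_fin -EFinD /tent.
have -> : `|x - y| = Num.max x y - Num.min x y.
  by rewrite distrC; case: leP => xy; [rewrite ger0_norm|rewrite ltr0_norm]; lra.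
move: (Num.max x y) (Num.min x y) => b a.
by case: ltP => h; congr (_%:E); case: ltP; lra.
Qed.

(** By [tent_overlap], the sum is the integral of the square of the
    combination of the indicators of the windows [[x j, x j + t]] with
    coefficients [a j]. *)
Lemma tent_psd (R : realType) (t : R) m (a x : 'I_m -> R) :
  0 <= \sum_(j < m) \sum_(l < m) tent t (x j - x l) * a j * a l.
Proof.
pose I j : set R := [set` `[x j, x j + t]].
pose mu := @lebesgue_measure R.
have mI j l : measurable (I j `&` I l).
  by apply: measurableI; exact: measurable_itv.
have intI j l : mu.-integrable setT
    (fun s : R => ((a j * a l)%:E * (\1_(I j `&` I l) s)%:E)%E).
  by apply: integrableZl => //; rewrite /I itv_translatesI; exact: integrable_indic_itv.
suff -> : \sum_(j < m) \sum_(l < m) tent t (x j - x l) * a j * a l =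
    fine (\int[mu]_s (((\sum_(j < m) a j * \1_(I j) s) ^+ 2)%:E))%E.
  by apply/fine_ge0/integral_ge0 => s _; rewrite lee_fin sqr_ge0.
have -> : (\int[mu]_s (((\sum_(j < m) a j * \1_(I j) s) ^+ 2)%:E))%E =
  (\int[mu]_s (\sum_(j < m) \sum_(l < m)
     ((a j * a l)%:E * (\1_(I j `&` I l) s)%:E)))%E.
  apply: eq_integral => s _; rewrite expr2 big_distrlr /= -sumEFin.
  apply: eq_bigr => j _; rewrite -sumEFin; apply: eq_bigr => l _.
  by rewrite -EFinM indicI /= mulrACA.
rewrite integral_sum //=; last by move=> j; apply: integrable_sum.
rewrite -[LHS]/(fine _%:E) -sumEFin; congr fine; apply: eq_bigr => j _.
rewrite integral_sum// -sumEFin; apply: eq_bigr => l _.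
rewrite integralZl//; last first.
  by rewrite /I itv_translatesI; exact: integrable_indic_itv.
rewrite integral_indic; [|exact: measurableT|exact: mI].
have -> : I j `&` I l `&` setT = I j `&` I l by exact: setIT.
rewrite [X in (_ * X)%E](_ : _ = (tent t (x j - x l))%:E); last exact: tent_overlap.
by rewrite -EFinM; congr (_%:E); ring.
Qed.

(** For a real symmetric kernel, the hermitian form at [c] is the sum of the
    real forms at the real and at the imaginary parts of [c]. *)
Lemma positive_definite_tent (R : realType) (t : R) :
  positive_definite (fun x => (tent t x)%:C%C).
Proof.
move=> m c x _.
have tentN y : tent t (- y) = tent t y by rewrite /tent normrN.
set S := (\sum_j _).
have SJ : Num.conj S = S.
  rewrite rmorph_sum; under eq_bigr do rewrite rmorph_sum.
  rewrite exchange_big /=; apply: eq_bigr => j _; apply: eq_bigr => l _.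
  rewrite !rmorphM /= conjCK -[Num.conj _%:C%C]/((_%:C%C)^*)%C conjc_real.
  rewrite -tentN opprB; ring.
have SR : complex.Re S =
   \sum_(j < m) \sum_(l < m) tent t (x j - x l) * complex.Re (c j) * complex.Re (c l) +
   \sum_(j < m) \sum_(l < m) tent t (x j - x l) * complex.Im (c j) * complex.Im (c l).
  have term (k : R) (u v : R[i]) : complex.Re (k%:C%C * u * Num.conj v) =
      k * complex.Re u * complex.Re v + k * complex.Im u * complex.Im v.
    case: u v => [u1 u2] [v1 v2] /=; ring.
  rewrite -big_split (raddf_sum (@complex.Re R : {additive Rcomplex R -> R})).
  apply: eq_bigr => j _; rewrite -big_split.
  rewrite (raddf_sum (@complex.Re R : {additive Rcomplex R -> R})).
  by apply: eq_bigr => l _; exact: term.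
have /complex_realP[k Sk] : S \is Num.real by apply/CrealP.
rewrite Sk ler0c; move: SR; rewrite Sk /= => ->.
by rewrite addr_ge0 ?tent_psd.
Qed.

(** * Limits of complex-valued functions *)

Lemma cvg_real_complex (R : realType) (u : nat -> R) (l : R) :
  u @ \oo --> l -> (fun n => (u n)%:C%C : R[i]^o) @ \oo --> (l%:C%C : R[i]^o).
Proof.
move=> ul; apply/cvgrPdist_le => e e0.
have /complex_realP[d de] : e \is Num.real by exact: gtr0_real.
have d0 : 0 < d by move: e0; rewrite de ltcR.
move/cvgrPdist_le : ul => /(_ d d0); apply: filterS => n h.
by rewrite -rmorphB normc_def /= expr0n addr0 sqrtr_sqr de lecR.
Qed.

(** A complex number is nonnegative if and only if it equals its norm, and
    this equality passes to the limit. *)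
Lemma positive_definite_lim (R : realType) (F : nat -> R -> R[i]) (f : R -> R[i]) :
  (forall x, (fun N => F N x : R[i]^o) @ \oo --> (f x : R[i]^o)) ->
  (forall N, positive_definite (F N)) -> positive_definite f.
Proof.
move=> Ff pF m c x m0.
pose S (h : R -> R[i]) : R[i]^o :=
  \sum_(j < m) \sum_(l < m) h (x j - x l) * c j * Num.conj (c l).
have SF : (fun N => S (F N)) @ \oo --> S f.
  apply: (cvg_big add_continuous) => j _; apply: (cvg_big add_continuous) => l _.
  by do 2!apply: cvgMr_tmp.
suff SE : `|S f| = S f by rewrite -[X in _ <= X]/(S f) -SE normr_ge0.
have nSF : (fun N => S (F N)) @ \oo --> (`|S f| : R[i]^o).
  have -> : (fun N => S (F N)) = (fun N => `|S (F N)|).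
    by apply/funext => N; rewrite ger0_norm//; exact: pF.
  exact: cvg_norm SF.
exact: (cvg_unique _ nSF SF).
Qed.

Lemma lipschitz_continuous_complex (R : realType) (g : R -> R[i]) (L : R) :
  0 < L ->
  (forall x y, `|g x - g y| <= (L * `|x - y|)%:C%C) ->
  continuous (g : R -> R[i]^o).
Proof.
move=> L0 gL x; apply/cvgrPdist_le => e e0.
have /complex_realP[d de] : e \is Num.real by exact: gtr0_real.
have d0 : 0 < d by move: e0; rewrite de ltcR.
near=> y; apply: le_trans (gL x y) _; rewrite de lecR mulrC -ler_pdivlMr//.
near: y; exact: cvgr_dist_le (divr_gt0 d0 L0).
Unshelve. all: by end_near. Qed.

(** * Components of open subsets of the line *)

Lemma component_interval (R : realType) (E : set R) x :
  is_interval (connected_component E x).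
Proof. exact/connected_intervalP/component_connected. Qed.

Lemma component_ball (R : realType) (E : set R) (q t x : R) :
  ball q t `<=` E -> ball q t x -> connected_component E q x.
Proof.
move=> qE qx; have t0 : 0 < t by move: qx; rewrite /ball /=; apply: le_lt_trans.
apply: (connected_component_max _ qE) => //; first exact: ballxx.
apply/connected_intervalP => y z; rewrite /ball /= !ltr_norml => hy hz s hs.
by rewrite ltr_norml; lra.
Qed.

(** The dichotomy behind the continuity of a function that has a different
    phase on each component: between two points that are not in the same
    component there is a point outside [E], where the function vanishes. *)
Lemma component_segmentP (R : realType) (E : set R) (x y : R) :
  connected_component E x y \/
  exists2 z, ~ E z & `|x - y| = `|x - z| + `|z - y|.
Proof.
have between (a b z : R) : a <= z <= b -> `|a - b| = `|a - z| + `|z - b|.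
  by move=> /andP[az zb]; rewrite !ler0_norm; lra.
have segment (a b : R) : a <= b -> connected_component E a b \/
    exists2 z, ~ E z & a <= z <= b.
  move=> ab; have [h|nE] := pselect (exists2 z, ~ E z & a <= z <= b); [by right|left].
  have SE : [set` `[a, b]] `<=` E.
    move=> z /=; rewrite in_itv /= => abz.
    by apply: contrapT => Ez; apply: nE; exists z.
  apply: (connected_component_max _ SE); rewrite /= ?in_itv /= ?lexx ?ab//.
  exact/connected_intervalP/interval_is_interval.
have [xy|/ltW yx] := leP x y.
  have [C|[z Ez /between xyz]] := segment _ _ xy; first by left.
  by right; exists z.
have [C|[z Ez /between yxz]] := segment _ _ yx.
  by left; exact: connected_component_sym.
by right; exists z => //; rewrite distrC yxz (distrC y z) (distrC z x) [LHS]addrC.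
Qed.

Lemma component_opp (R : realType) (E : set R) (x y : R) :
  (forall z, E z -> E (- z)) ->
  connected_component E x y -> connected_component E (- x) (- y).
Proof.
move=> symE [B [Bx BE cB] By]; exists [set - z | z in B]; last by exists y.
split; first by exists x.
  by move=> _ [z Bz <-]; apply/symE/BE.
apply/connected_intervalP => _ _ [a Ba <-] [b Bb <-] c /andP[ac cb].
exists (- c); last by rewrite opprK.
by move/connected_intervalP : cB => /(_ b a Bb Ba); apply; lra.
Qed.

Section wide.
Context (R : realType) (E : set R) (s : R).
Hypothesis symE : forall z, E z -> E (- z).
Hypothesis wideE : forall x, E x ->
  exists a b, [/\ connected_component E x a, connected_component E x b & 2 * s < b - a].

(** A segment of length greater than [2 * s] in the component of 0 has an end
    at distance more than [s] from 0, so that the component contains one half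
    of the ball; the symmetry of [E] gives the other half. *)
Lemma wide_ball0 : E 0 -> ball 0 s `<=` E.
Proof.
move=> E0; have [a [b [Ca Cb ab]]] := wideE E0.
have C0 := connected_component_refl E0.
have I0 := @component_interval _ E 0.
have subE := @connected_component_sub _ E 0.
move=> x; rewrite /ball /= sub0r normrN ltr_norml => xs.
have [x0|/ltW x0] := leP 0 x; have [sb|bs] := ltP s b.
- by apply/subE/(I0 0 b) => //; lra.
- by rewrite -[x]opprK; apply/symE/subE/(I0 a 0) => //; lra.
- by rewrite -[x]opprK; apply/symE/subE/(I0 0 b) => //; lra.
- by apply/subE/(I0 a 0) => //; lra.
Qed.

(** Openness makes [x] interior to a segment [[lo, hi]] of its component with
    [hi - lo > 2 * s]; the admissible centers [q] then fill a nonempty open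
    interval, so that one of them is rational. *)
Lemma wide_cover (x : R) : open E -> 0 < s -> E x ->
  exists q : rat, ball (ratr q : R) s x /\ ball (ratr q : R) s `<=` E.
Proof.
move=> openE s0 Ex; have [a [b [Ca Cb ab]]] := wideE Ex.
have /nbhs_ballP[e /= e0 eE] : nbhs x E by exact: open_nbhs_nbhs.
have CB y : ball x e y -> connected_component E x y by exact: component_ball.
have Cl : connected_component E x (x - e / 2).
  by apply: CB; rewrite /ball /= ltr_norml; lra.
have Cr : connected_component E x (x + e / 2).
  by apply: CB; rewrite /ball /= ltr_norml; lra.
have I := @component_interval _ E x.
pose lo := Num.min a (x - e / 2); pose hi := Num.max b (x + e / 2).
have Clo : connected_component E x lo by rewrite /lo; case: leP.
have Chi : connected_component E x hi by rewrite /hi; case: leP.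
have [loa lox] : lo <= a /\ lo <= x - e / 2 by rewrite /lo !ge_min !lexx orbT.
have [hib hix] : b <= hi /\ x + e / 2 <= hi by rewrite /hi !le_max !lexx orbT.
have /rat_in_itvoo[q] : Num.max (lo + s) (x - s) < Num.min (hi - s) (x + s).
  by rewrite lt_min !gt_max; apply/andP; split; apply/andP; split; lra.
rewrite in_itv /= lt_min gt_max => /andP[/andP[q1 q2] /andP[q3 q4]].
exists q; split; first by rewrite /ball /= ltr_norml; apply/andP; split; lra.
move=> y; rewrite /ball /= ltr_norml => /andP[y1 y2].
by apply: (@connected_component_sub _ E x); apply: (I lo hi) => //; apply/andP; split; lra.
Qed.
End wide.

(** * The profile and its twists by phases *)

(** Enumerates the rationals; a repeated value only changes the weight that a
    center receives in total, so that the default value is harmless. *)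
Definition center (R : realType) (k : nat) : R :=
  if unpickle k is Some q then ratr (q : rat) else 0.

Section profile.
Context (R : realType) (E : set R) (t : R).

Definition weight (k : nat) : R :=
  if `[< ball (center R k) t `<=` E >] then 1 / (2 ^ (k + 1))%:R else 0.

Definition profile_term (x : R) (k : nat) : R :=
  weight k * (2 * tent t x + tent t (x - center R k) + tent t (x + center R k)).

Definition profile (x : R) : R := limn (series (profile_term x)).

Let dyadic (r : R) (k : nat) : R := r / (2 ^ (k + 1))%:R.

Let dyadic_cvg r : series (dyadic r) @ \oo --> r.
Proof. by have := @cvg_geometric_series_half R r 0; rewrite expr0 divr1; apply. Qed.

Lemma weight_ge0 k : 0 <= weight k.
Proof. by rewrite /weight; case: ifP. Qed.

Lemma weight_le k : weight k <= dyadic 1 k.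
Proof. by rewrite /weight; case: ifP => // _; rewrite /dyadic divr_ge0. Qed.

Lemma profile_term_ge0 x k : 0 <= profile_term x k.
Proof. by rewrite mulr_ge0 ?weight_ge0// !addr_ge0 ?mulr_ge0 ?tent_ge0. Qed.

Lemma profile_cvg (t0 : 0 <= t) x : series (profile_term x) @ \oo --> profile x.
Proof.
apply: (series_le_cvg (v_ := dyadic (4 * t))).
- exact: profile_term_ge0.
- by move=> k; apply: divr_ge0 => //; apply: mulr_ge0.
- move=> k; rewrite /dyadic [leRHS]mulrC -[in leRHS](mul1r _^-1).
  apply: ler_pM => //; [exact: weight_ge0| |exact: weight_le|].
    by rewrite !addr_ge0 ?mulr_ge0 ?tent_ge0.
  have := tent_le t0 (x + center R k); have := tent_le t0 (x - center R k).
  by have := tent_le t0 x; lra.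
- exact/cvgP/dyadic_cvg.
Qed.

Lemma profile_le_lipschitz (t0 : 0 <= t) x y : profile x <= profile y + 4 * `|x - y|.
Proof.
have cvgR := cvgD (@profile_cvg t0 y) (@dyadic_cvg (4 * `|x - y|)).
apply: (ler_cvg_to (@profile_cvg t0 x) (cvgR _)); near=> N.
rewrite [leRHS](_ : _ = \sum_(0 <= k < N) (profile_term y k + dyadic (4 * `|x - y|) k));
  last by rewrite big_split.
apply: ler_sum => k _.
rewrite /dyadic /profile_term.
apply: (@le_trans _ _ (weight k * (2 * tent t y + tent t (y - center R k) +
    tent t (y + center R k) + 4 * `|x - y|))).
  rewrite ler_wpM2l ?weight_ge0//.
  have := tent_lipschitz t x y; have := tent_lipschitz t (x - center R k) (y - center R k).
  have := tent_lipschitz t (x + center R k) (y + center R k).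
  rewrite (_ : x - center R k - (y - center R k) = x - y); last by ring.
  rewrite (_ : x + center R k - (y + center R k) = x - y); last by ring.
  by lra.
rewrite mulrDr lerD2l -[leRHS]mulr1 mulrAC [leRHS]mulrC [leRHS]mulrCA mulrC.
rewrite ler_wpM2l ?mulr_ge0//.
by have := weight_le k; rewrite /dyadic; lra.
Unshelve. all: by end_near. Qed.

Lemma profile_lipschitz (t0 : 0 <= t) x y : `|profile x - profile y| <= 4 * `|x - y|.
Proof.
have := profile_le_lipschitz t0 x y; have := profile_le_lipschitz t0 y x.
by rewrite (distrC y) ler_norml; lra.
Qed.

Lemma profileN x : profile (- x) = profile x.
Proof.
rewrite /profile; congr (limn (series _)); apply/funext => k.
rewrite /profile_term /tent normrN.
by rewrite -opprD normrN (_ : - x + _ = - (x - center R k)) ?normrN; ring.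
Qed.

Hypothesis t_gt0 : 0 < t.
Hypothesis symE : forall x, E x -> E (- x).
Hypothesis ball0E : ball 0 t `<=` E.
Hypothesis coverE : forall x, E x -> exists q : rat,
  ball (ratr q : R) t x /\ ball (ratr q : R) t `<=` E.

(** One positive term suffices: that of a center whose ball contains [x]. *)
Lemma profile_gt0 x : E x -> 0 < profile x.
Proof.
move=> /coverE[q [qx qE]].
pose k := pickle q.
have ck : center R k = ratr q by rewrite /center pickleK.
have wk : 0 < weight k.
  by rewrite /weight ck; case: asboolP => // _; rewrite divr_gt0// ltr0n expn_gt0.
have tk : 0 < profile_term x k.
  rewrite mulr_gt0// ck ltr_wpDr ?tent_ge0// ltr_wpDl ?mulr_ge0 ?tent_ge0//.
  by apply: tent_gt0; rewrite distrC.
have cvgx := @profile_cvg (ltW t_gt0) x.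
apply: (@lt_le_trans _ _ (series (profile_term x) k.+1)).
  rewrite /series /= big_nat_recr//= ltr_wpDl//.
  by apply: sumr_ge0 => i _; exact: profile_term_ge0.
apply: nondecreasing_cvgn_le (cvgP _ cvgx) _.
apply/nondecreasing_seqP => n; rewrite /series /= big_nat_recr//= lerDl.
exact: profile_term_ge0.
Qed.

Lemma profile_eq0 x : ~ E x -> profile x = 0.
Proof.
move=> nE; apply: cvg_lim => //.
rewrite (_ : series _ = cst 0); first exact: cvg_cst.
apply/funext => N; rewrite /series /= big1// => k _; rewrite /profile_term /weight.
case: asboolP => [kE|_]; last by rewrite mul0r.
rewrite !tent_eq0 ?mulr0 ?addr0 ?mulr0//; rewrite leNgt; apply/negP => h; apply: nE.
- rewrite -[x]opprK; apply/symE/kE.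
  by rewrite /ball /= opprK addrC.
- by apply: kE; rewrite /ball /= distrC.
- by apply: ball0E; rewrite /ball /= sub0r normrN.
Qed.

(** The symmetry in [- x] is forced by positive definiteness of the product
    with the profile, constancy on components by its continuity when the
    values are roots of unity. *)
Definition phase (w : R -> R[i]) : Prop :=
  [/\ w 0 = 1, forall x, `|w x| = 1, forall x, w (- x) = Num.conj (w x)
    & forall x y, connected_component E x y -> w x = w y].

(** Each of the three bumps of [profile_term] is supported in a ball contained
    in [E]: around 0, where [w] is 1, around the center, or around its
    opposite. So [w x] may be replaced by the value of [w] there. *)
Lemma phase_twist w k x : phase w ->
  w x * (profile_term x k)%:C%C = (weight k)%:C%C *
    (2 * (tent t x)%:C%C + w (center R k) * (tent t (x - center R k))%:C%C
       + Num.conj (w (center R k)) * (tent t (x + center R k))%:C%C).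
Proof.
move=> [w0 _ wN wC]; rewrite /profile_term /weight.
case: asboolP => [kE|_]; last by rewrite !mul0r mulr0.
rewrite rmorphM mulrCA; congr (_ * _); rewrite !rmorphD !rmorphM !mulrDr.
congr (_ + _ + _).
- have [tx|xt] := leP t `|x|; first by rewrite tent_eq0// !mulr0.
  rewrite (_ : w x = 1) ?mul1r ?rmorph_nat// -w0; apply/esym/wC.
  by apply: component_ball ball0E _; rewrite /ball /= sub0r normrN.
- have [tx|xt] := leP t `|x - center R k|; first by rewrite tent_eq0// !mulr0.
  rewrite (_ : w x = w (center R k))//; apply/esym/wC.
  by apply: component_ball kE _; rewrite /ball /= distrC.
- have [tx|xt] := leP t `|x + center R k|; first by rewrite tent_eq0// !mulr0.
  rewrite -[X in w X]opprK wN (_ : w (- x) = w (center R k))//; apply/esym/wC.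
  by apply: component_ball kE _; rewrite /ball /= opprK addrC.
Qed.

Lemma phase_positive_definite w : phase w ->
  positive_definite (fun x => w x * (profile x)%:C%C).
Proof.
move=> pw; have [_ wnorm _ _] := pw.
pose F N x := \sum_(0 <= k < N) w x * (profile_term x k)%:C%C.
apply: (@positive_definite_lim _ F) => [x|N].
  rewrite (_ : (fun N => _) = (fun N => w x * (series (profile_term x) N)%:C%C)).
    apply: cvgMl_tmp; apply: cvg_real_complex; exact: (@profile_cvg (ltW t_gt0) x).
  by apply/funext => N; rewrite /F rmorph_sum mulr_sumr.
have pF k : positive_definite (fun x => w x * (profile_term x k)%:C%C).
  under eq_fun do rewrite phase_twist//.
  have pk := positive_definite_translates (center R k) (wnorm (center R k))
    (positive_definite_tent t).
  by move=> m c x m0; apply: (positive_definiteZ _ pk); rewrite // ler0c weight_ge0.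
by move=> m c x m0; apply: (positive_definite_sum _ pF).
Qed.

(** If [x] and [y] are not in the same component, [profile] vanishes at some [z]
    between them, and [|profile x| + |profile y|] is bounded through [z]. *)
Lemma phase_lipschitz w x y : phase w ->
  `|w x * (profile x)%:C%C - w y * (profile y)%:C%C| <= (4 * `|x - y|)%:C%C.
Proof.
move=> [_ wnorm _ wC].
have normC (r : R) : `|r%:C%C| = `|r|%:C%C :> R[i].
  by rewrite normc_def /= expr0n addr0 sqrtr_sqr.
have [/wC <-|[z /profile_eq0 z0 xyz]] := component_segmentP E x y.
  rewrite -mulrBr normrM wnorm mul1r -rmorphB normC lecR.
  exact: (profile_lipschitz (ltW t_gt0)).
apply: le_trans (ler_normB _ _) _; rewrite !normrM !wnorm !mul1r !normC -rmorphD lecR.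
have := profile_lipschitz (ltW t_gt0) x z; have := profile_lipschitz (ltW t_gt0) z y.
by rewrite z0 subr0 sub0r normrN xyz; lra.
Qed.

Lemma phase_PD w : E 0 -> phase w -> PD (fun x => w x * (profile x)%:C%C).
Proof.
move=> E0 pw; split.
- by apply: (@lipschitz_continuous_complex _ _ 4) => // x y; exact: phase_lipschitz.
- exact: phase_positive_definite.
- by exists 0; case: pw => -> _ _ _; rewrite mul1r fmorph_eq0 gt_eqF// profile_gt0.
Qed.

End profile.

(** * Roots of the profile power *)

Lemma PD_exp (R : realType) (f : R -> R[i]) n :
  (forall x, f (- x) = Num.conj (f x)) -> PD f -> PD (fun x => f x ^+ n).
Proof.
move=> hf [cf pf [x fx]]; split.
- elim: n => [|n IHn] y; first exact: cvg_cst.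
  under eq_fun do rewrite exprS.
  by apply: (@cvgM _ _ (nbhs y)); [exact: cf|exact: IHn].
- exact: positive_definiteX.
- by exists x; rewrite expf_neq0.
Qed.

(** Any root of [1 + X + ... + X^(n-1)] will do: the value at 1 is [n != 0]. *)
Lemma exists_root_of_unity (C : numClosedFieldType) n : (2 <= n)%N ->
  exists z : C, z != 1 /\ z ^+ n = 1.
Proof.
move=> n2; have /closed_rootP[z] : size (\poly_(i < n) (1 : C)) != 1%N.
  by rewrite size_poly_eq ?oner_eq0// gtn_eqF.
rewrite /root horner_poly => /eqP rz; exists z; split.
  apply/eqP => z1; move/eqP: rz; rewrite z1.
  under eq_bigr do rewrite expr1n mulr1.
  rewrite sumr_const card_ord pnatr_eq0 => /eqP n0.
  by rewrite n0 in n2.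
apply/eqP; rewrite -subr_eq0 subrX1 (_ : \sum_(i < n) z ^+ i = 0) ?mulr0//.
by rewrite -[RHS]rz; apply: eq_bigr => i _; rewrite mul1r.
Qed.

Definition component_phase (R : realType) (C : set R) (z : R[i]) (x : R) : R[i] :=
  if `[< C x >] then z else if `[< C (- x) >] then Num.conj z else 1.

Section component_phase.
Context (R : realType) (E : set R) (x0 : R) (z : R[i]) (n : nat).
Hypothesis symE : forall x, E x -> E (- x).
Hypothesis z1 : z != 1.
Hypothesis zn : z ^+ n = 1.
Hypothesis n_gt0 : (0 < n)%N.
Let C := connected_component E x0.
Hypothesis nC0 : ~ C 0.

(** Otherwise the interval [C] would contain 0. This is what makes the two
    conjugate values of [component_phase] compatible, also for [z] nonreal. *)
Lemma component_opp_disjoint x : C x -> C (- x) -> False.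
Proof.
move=> Cx CNx; apply: nC0; have I := @component_interval _ E x0.
have [x_ge0|/ltW x_le0] := leP 0 x; [apply: (I (- x) x)|apply: (I x (- x))] => //; lra.
Qed.

Lemma component_phaseX x : component_phase C z x ^+ n = 1.
Proof.
rewrite /component_phase; case: ifP => _ //; case: ifP => _; last by rewrite expr1n.
by rewrite -rmorphXn zn rmorph1.
Qed.

Lemma component_phaseP : phase E (component_phase C z).
Proof.
split.
- rewrite /component_phase oppr0; case: asboolP => // Cx.
- move=> x; apply/eqP; rewrite -(@pexpr_eq1 _ _ n) ?normr_ge0//.
  by rewrite -normrX component_phaseX normr1.
- move=> x; rewrite /component_phase opprK.
  case: asboolP => [CNx|_]; case: asboolP => [Cx|_] //; rewrite ?conjCK ?rmorph1//.
  by case: (component_opp_disjoint Cx CNx).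
- move=> x y xy.
  have Ciff u v : connected_component E u v -> `[< C u >] = `[< C v >].
    move=> uv; apply: asbool_equiv_eq; split => h.
      exact: connected_component_trans uv.
    exact: connected_component_trans (connected_component_sym uv).
  by rewrite /component_phase (Ciff x y)// (Ciff (- x) (- y))//; exact: component_opp.
Qed.

Lemma component_phase_neq1 x : component_phase C z x != 1 <-> C x \/ C (- x).
Proof.
rewrite /component_phase; case: asboolP => Cx; first by split => // _; left.
case: asboolP => CNx.
  split => [_|_]; first by right.
  by apply: contra z1 => /eqP h; rewrite -[z]conjCK h rmorph1.
by rewrite eqxx; split => // -[].
Qed.
End component_phase.

Theorem theorem5 (R : realType) (E : set R) (sigma : R)
  (openE : open E)
  (E0 : E 0)
  (symE : [set - x | x in E] = E)
  (infE : infinite_set (components E))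
  (sigma_gt0 : 0 < sigma)
  (diamE : ereal_inf [set diameter C | C in components E] = (2 * sigma)%:E)
  (n : nat) (n_ge2 : (2 <= n)%N) :
  exists f : R -> R[i],
    [/\ PDn n f, nonzero_set f = E & infinite_set (Dn n f)].
Proof.
have {}symE x : E x -> E (- x) by move=> Ex; rewrite -symE; exists x.
have n_gt0 : (0 < n)%N by apply: leq_trans n_ge2.
(* Half of sigma, rather than sigma: the centers q with ball q t in a component
   then fill an interval of positive length, which contains rationals. *)
pose t := sigma / 2.
have t_gt0 : 0 < t by rewrite divr_gt0.
have wideE x : E x -> exists a b, [/\ connected_component E x a,
    connected_component E x b & 2 * t < b - a].
  move=> Ex.
  have : (sigma%:E < diameter (connected_component E x))%E.
    apply: (@lt_le_trans _ _ (2 * sigma)%:E); first by rewrite lte_fin; lra.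
    by rewrite -diamE; apply: ereal_inf_lbound;
      exists (connected_component E x) => //; exists x.
  move=> /ereal_sup_gt[_ [a Ca [b Cb <-]]]; rewrite lte_fin => ab.
  by have [h|h] := leP b a; [exists b, a|exists a, b]; split => //;
    move: ab; rewrite /t; [rewrite ger0_norm|rewrite ltr0_norm]; lra.
have ball0E := wide_ball0 symE wideE E0.
have coverE x := @wide_cover _ E t wideE x openE t_gt0.
pose p := profile E t.
have p_gt0 x : E x -> 0 < p x by exact: profile_gt0.
have p_eq0 x : ~ E x -> p x = 0 by exact: profile_eq0.
have PDp w : phase E w -> PD (fun x => w x * (p x)%:C%C) by exact: phase_PD.
have phase1 : phase E (fun=> 1) by split => // *; rewrite ?normr1 ?rmorph1.
have PDp1 : PD (fun x => (p x)%:C%C : R[i]).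
  by have := PDp _ phase1; under eq_fun do rewrite mul1r.
have pN x : p (- x) = p x by exact: profileN.
have Dp w : phase E w -> (forall x, w x ^+ n = 1) ->
    Dn n (fun x => (p x)%:C%C ^+ n) (fun x => w x * (p x)%:C%C).
  by move=> pw wn; split=> [|x]; [exact: PDp|rewrite exprMn wn mul1r].
exists (fun x => (p x)%:C%C ^+ n); split.
- split; last by exists (fun x => (p x)%:C%C).
  by apply: PD_exp => // x; rewrite pN -[RHS]/((_%:C%C)^*)%C conjc_real.
- apply/seteqP; split => x.
    rewrite /nonzero_set /= expf_eq0 n_gt0 /= => px.
    by apply: contrapT => nEx; move: px; rewrite p_eq0// eqxx.
  by move=> Ex; rewrite /nonzero_set /= expf_neq0// fmorph_eq0 gt_eqF// p_gt0.
have [z [z1 zn]] := exists_root_of_unity R[i] n_ge2.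
move=> finD; apply: infE.
(* A component avoiding 0 lies on one side of 0, so it is recovered from the
   root that it defines by looking at this side only. *)
pose pos (g : R -> R[i]) : set R := [set x | 0 < x /\ g x != (p x)%:C%C].
pose neg (g : R -> R[i]) : set R := [set x | x < 0 /\ g x != (p x)%:C%C].
apply: (@sub_finite_set _ _ ([set connected_component E 0] `|`
  (pos @` Dn n (fun x => (p x)%:C%C ^+ n) `|` neg @` Dn n (fun x => (p x)%:C%C ^+ n)))).
  move=> _ [x Ex <-]; set C := connected_component E x.
  have [C0|nC0] := pselect (C 0).
    by left; apply: same_connected_component; exact: C0.
  right.
  pose g y := component_phase C z y * (p y)%:C%C.
  have Dg : Dn n (fun x => (p x)%:C%C ^+ n) g.
    apply: Dp; first exact: (component_phaseP symE zn n_gt0 nC0).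
    by move=> y; apply: component_phaseX.
  have gP y : g y != (p y)%:C%C <-> C y \/ C (- y).
    rewrite -(@component_phase_neq1 R E x z z1 y) /g; split.
      by apply: contra => /eqP ->; rewrite mul1r.
    move=> w1; have Ey : E y.
      move/(@component_phase_neq1 R E x z z1 y) : w1 => [/connected_component_sub//|].
      by move=> /connected_component_sub/symE; rewrite opprK.
    have py : (p y)%:C%C != 0 :> R[i] by rewrite fmorph_eq0 gt_eqF// p_gt0.
    by rewrite -subr_eq0 -{2}[(p y)%:C%C]mul1r -mulrBl mulf_neq0// subr_eq0.
  have I : is_interval C by exact: component_interval.
  have Cx : C x by exact: connected_component_refl.
  have [x_gt0|x_le0] := ltP 0 x; [left|right]; exists g => //.
    apply/seteqP; split => [y [y0 /gP[//|CNy]]|y Cy].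
      by case: nC0; apply: (I (- y) x) => //; lra.
    split; last by apply/gP; left.
    by rewrite ltNge; apply/negP => y0; apply: nC0; apply: (I y x) => //; lra.
  apply/seteqP; split => [y [y0 /gP[//|CNy]]|y Cy].
    by case: nC0; apply: (I x (- y)) => //; lra.
  split; last by apply/gP; left.
  by rewrite ltNge; apply/negP => y0; apply: nC0; apply: (I x y) => //; lra.
rewrite !finite_setU; split; first exact: finite_set1.
by split; apply: finite_image.
Qed.
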